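(* Let $G$ be a graph with orientation $D$, let $A$ be a finite additive Abelian group, let $f:E(G)\to A$ be a function, and let $\alpha=\alpha_{D,f}$ be the assigning of $G$ induced by $f$. Then the number $P\big(D(G),f;A\big)$ of $(A,f)$-colorings of $G$ under $D$ satisfies \[ P\big(D(G),f;A\big)=\sum_{H} (-1)^{|E(H)|}|A|^{c(H)}, \] where the sum is over all $\alpha$-compatible spanning subgraphs $H$ of $G$.
   Context: Graphs are finite and may have loops and multiple edges. An orientation $D$ of $G$ assigns a direction to each edge. A vertex coloring $c:V(G)\to A$ is an $(A,f)$-coloring of $G$ under $D$ if $c(v)-c(u)\neq f(e)$ for each edge $e=uv$ oriented from $u$ to $v$ under $D$ (for a loop, $u=v$); $P(D(G),f;A)$ is the number of these. A spanning subgraph of $G$ is a subgraph with vertex set $V(G)$; $c(H)$ is the number of connected components of $H$. A cycle of $G$ is a connected 2-regular subgraph (a loop with its vertex is a cycle with one edge; two parallel edges form a cycle); $\mathcal{C}(G)$ is the set of cycles of $G$. An assigning of $G$ is a map $\alpha:\mathcal{C}(G)\to\{0,1\}$. For each cycle $C$ fix one of its two directions $o(C)$ and define $\eta_{D(C)}:E(G)\to\{0,\pm1\}$ by $\eta_{D(C)}(e)=1$ if $e\in E(C)$ and the direction of $e$ under $D$ is consistent with $o(C)$, $-1$ if $e\in E(C)$ and the direction of $e$ is opposite to $o(C)$, and $0$ if $e\notin E(C)$. The assigning $\alpha_{D,f}$ induced by $f:E(G)\to A$ is $\alpha_{D,f}(C)=0$ if $\sum_{e\in E(C)}\eta_{D(C)}(e)f(e)=0$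 and $\alpha_{D,f}(C)=1$ otherwise (independent of the choices $o(C)$). A subgraph $H$ of $G$ is $\alpha$-compatible if $\alpha(C)=0$ for every cycle $C$ of $H$. *)

(* Defs.v *)
From mathcomp Require Import all_boot all_order all_algebra.

Set Implicit Arguments.
Unset Strict Implicit.
Unset Printing Implicit Defensive.
Import GRing.Theory.
Local Open Scope ring_scope.

(** An edge [e] has two ends (half-sub_edges) [(e, true)] and [(e, false)], attached
    to the vertices [endpoint e true] and [endpoint e false]. The labels only
    name the two ends: they do not direct the edge. Loops and parallel sub_edges
    are allowed, and a loop has two distinct ends, hence two directions. *)
Record graph := Graph {
  vertex : finType;
  edge : finType;
  endpoint : edge -> bool -> vertex
}.

(** The direction of [e] is given by the end at which [e] arrives. *)
Definition orientation (G : graph) := edge G -> bool.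

Section Graph.
Variable G : graph.

Definition edge_head (D : orientation G) (e : edge G) : vertex G :=
  endpoint e (D e).
Definition edge_tail (D : orientation G) (e : edge G) : vertex G :=
  endpoint e (~~ D e).

Definition is_subgraph (H : {set vertex G} * {set edge G}) : bool :=
  [forall e in H.2, forall b, endpoint e b \in H.1].

Definition subgraph := {H : {set vertex G} * {set edge G} | is_subgraph H}.

Definition sub_verts (H : subgraph) : {set vertex G} := (val H).1.
Definition sub_edges (H : subgraph) : {set edge G} := (val H).2.

Definition subgraph_of (K H : subgraph) : bool :=
  (sub_verts K \subset sub_verts H) && (sub_edges K \subset sub_edges H).

Definition spanning (H : subgraph) : bool := sub_verts H == setT.

Definition adj (H : subgraph) : rel (vertex G) :=
  fun u v => [exists e in sub_edges H, exists b,
    (endpoint e b == u) && (endpoint e (~~ b) == v)].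

Definition ncomponents (H : subgraph) : nat := n_comp (adj H) (sub_verts H).

(** Ends are counted, so that a loop contributes 2. *)
Definition degree (H : subgraph) (v : vertex G) : nat :=
  #|[set d : edge G * bool | (d.1 \in sub_edges H) && (endpoint d.1 d.2 == v)]|.

Definition is_cycle (C : subgraph) : bool :=
  (ncomponents C == 1)%N && [forall v in sub_verts C, degree C v == 2%N].

Definition graph_cycle := {C : subgraph | is_cycle C}.

(** A direction of [C] orients its edges along a traversal of [C]: every vertex
    is entered once and left once. The values of [o] outside [C] are
    irrelevant. *)
Definition is_direction (C : graph_cycle) (o : orientation G) : Prop :=
  forall v, v \in sub_verts (val C) ->
    #|[set e in sub_edges (val C) | edge_head o e == v]| = 1%N /\
    #|[set e in sub_edges (val C) | edge_tail o e == v]| = 1%N.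

Lemma direction_exists (C : graph_cycle) : exists o, is_direction C o.
Proof.
pose dart := (edge G * bool)%type.
pose vtx (d : dart) := endpoint d.1 d.2.
pose s (d : dart) : dart := (d.1, ~~ d.2).
pose X := [set d : dart | d.1 \in sub_edges (val C)].
have sK : involutive s by case=> e b; rewrite /s /= negbK.
have sX d : (s d \in X) = (d \in X) by rewrite !inE.
have s_neq d : s d != d by case: d => e []; rewrite /s xpair_eqE andbF.
have deg2 d : d \in X -> #|[set d' in X | vtx d' == vtx d]| = 2%N.
  rewrite inE => dX; have := valP C; case/andP=> _ /forall_inP/(_ (vtx d)).
  rewrite /degree => H; rewrite -(eqP (H _)); last first.
    by have /forall_inP/(_ _ dX)/forallP/(_ d.2) := valP (val C).
  by apply: eq_card => d'; rewrite !inE.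
pose t (d : dart) : dart :=
  odflt d [pick d' | [&& d \in X, d' \in X, d' != d & vtx d' == vtx d]].
have tP d : d \in X -> [set d' in X | vtx d' == vtx d] = [set d; t d]
    /\ [/\ t d \in X, t d != d & vtx (t d) = vtx d].
  move=> dX; have /eqP/cards2P[x [y [nxy E]]] := deg2 _ dX.
  have Ht : [/\ t d \in X, t d != d & vtx (t d) = vtx d].
    rewrite /t; case: pickP => [d' /and4P[_ ? ? /eqP ->] //|no].
    have Hx : x \in [set x; y] by rewrite !inE eqxx.
    have Hy : y \in [set x; y] by rewrite !inE eqxx orbT.
    have : d \in [set x; y] by rewrite -E inE dX eqxx.
    move: Hx Hy; rewrite -E [x \in _]inE [y \in _]inE.
    move=> /andP[x1 x2] /andP[y1 y2].
    rewrite E !inE => /orP[] /eqP Ed.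
    - by have := no y; rewrite dX y1 y2 Ed eq_sym nxy.
    - by have := no x; rewrite dX x1 x2 Ed nxy.
  split=> //; case: Ht => tX tn tv.
  apply/esym/eqP; rewrite eqEcard cards2 eq_sym tn deg2 // leqnn andbT.
  apply/subsetP => z; rewrite !inE => /orP[] /eqP ->.
    by rewrite eqxx andbT; move: dX; rewrite inE.
  by rewrite tv eqxx andbT; move: tX; rewrite inE.
have tN d : d \notin X -> t d = d.
  by move=> /negPf dX; rewrite /t; case: pickP => // d'; rewrite dX.
have tK : involutive t.
  move=> d; case: (boolP (d \in X)) => dX; last by rewrite !tN.
  have [E [tX tn tv]] := tP _ dX; have [_ [ttX ttn ttv]] := tP _ tX.
  have : t (t d) \in [set d' in X | vtx d' == vtx d].
    by rewrite inE ttX ttv tv eqxx.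
  by rewrite E !inE (negPf ttn) orbF => /eqP.
pose p d := t (s d).
have pI : injective p by apply: inj_comp; [exact: inv_inj tK|exact: inv_inj sK].
have pX d : d \in X -> p d \in X.
  by move=> dX; have [_ []] := tP (s d) (etrans (sX d) dX).
have sep n d : d \in X -> iter n p d != s d.
  elim/ltn_ind: n d => -[|[|n]] IH d dX /=.
  - by rewrite eq_sym.
  - by have [_ []] := tP (s d) (etrans (sX d) dX).
  - apply: contra (IH n _ (p d) (pX _ dX)) => //.
    rewrite -iterSr -{1}[s d]tK -{1}[t (s d)]sK => /eqP/pI /= ->.
    exact: eqxx.
pose r (d : dart) := enum_rank (froot p d).
have rP d d' : fconnect p d d' -> r d = r d'.
  by move=> H; congr enum_rank; apply/eqP; rewrite root_connect //;
     exact: fconnect_sym.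
have r_s d : d \in X -> r d != r (s d).
  move=> dX; rewrite /r (inj_eq enum_rank_inj) root_connect;
    last exact: fconnect_sym.
  apply/negP => /iter_findex E.
  by have := sep (findex p d (s d)) d dX; rewrite E eqxx.
pose b d := (r d < r (s d))%N.
have b_s d : d \in X -> b (s d) = ~~ b d.
  move=> dX; rewrite /b sK; have := r_s _ dX.
  by rewrite -(inj_eq val_inj) /=; case: ltngtP.
have b_t d : d \in X -> b (t d) = ~~ b d.
  move=> dX; rewrite -b_s // /b sK.
  have -> : r (t d) = r (s d) by apply/esym/rP; rewrite -{2}[d]sK fconnect1.
  have -> // : r (s (t d)) = r d.
  by apply: rP; rewrite -{2}[d]tK -{2}[t d]sK fconnect1.
exists (fun e => b (e, true)).
have bE e x : e \in sub_edges (val C) -> b (e, b (e, true) (+) x) = ~~ x.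
  move=> eC; have := b_s (e, true); rewrite inE => /(_ eC); rewrite /s /=.
  by case E: (b (e, true)); case: x => //= ->.
have key v x : v \in sub_verts (val C) ->
   #|[set e in sub_edges (val C) | endpoint e (b (e, true) (+) x) == v]| = 1%N.
  move=> vC; have [d dX dv] : exists2 d, d \in X & vtx d = v.
    have := valP C; case/andP=> _ /forall_inP/(_ v vC) /eqP Hd.
    have /card_gt0P [d] : (0 < degree (val C) v)%N by rewrite Hd.
    by rewrite inE => /andP[? /eqP ?]; exists d; rewrite // inE.
  have [c cX [cv cb]] : exists2 c, c \in X & vtx c = v /\ b c = ~~ x.
    have [_ [tX _ tv]] := tP _ dX.
    case: (eqVneq (b d) (~~ x)) => [?|]; first by exists d.
    move=> n; exists (t d); rewrite // tv b_t //.
    by split=> //; case: (b d) x n => [] [].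
  apply/eqP/cards1P; exists c.1; apply/setP => e; rewrite !inE.
  apply/andP/eqP => [[eC /eqP ev]|->].
    have [E _] := tP _ cX.
    have : (e, b (e, true) (+) x) \in [set d' in X | vtx d' == vtx c].
      by rewrite !inE eC /= cv /vtx /= ev.
    rewrite E !inE => /orP[/eqP <- //|/eqP Et].
    have := bE e x eC; rewrite Et b_t // cb.
    by case: (x).
  have cC : c.1 \in sub_edges (val C) by move: cX; rewrite inE.
  split=> //; rewrite -cv /vtx; suff -> : b (c.1, true) (+) x = c.2 by [].
  case: c cX cv cb cC => e1 y cX _ /= cb cC.
  have := b_s (e1, true); rewrite inE => /(_ cC); rewrite /s /=.
  by case: y cb {cX} => ->; case: x => // /esym; case: (b _).
move=> v vC; split.
  by rewrite -(key v false vC); apply: eq_card => e; rewrite !inE addbF.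
by rewrite -(key v true vC); apply: eq_card => e; rewrite !inE addbT.
Qed.

Definition eta (D : orientation G) (C : graph_cycle) (o : orientation G)
    (e : edge G) : int :=
  if e \in sub_edges (val C) then (if D e == o e then 1 else -1) else 0.

(** [false] and [true] stand for 0 and 1. *)
Definition assigning := graph_cycle -> bool.

Definition compatible (alpha : assigning) (H : subgraph) : bool :=
  [forall C : graph_cycle, subgraph_of (val C) H ==> (alpha C == false)].

Variable A : finZmodType.

Definition induced_assigning (D : orientation G)
    (o : graph_cycle -> orientation G)
    (f : edge G -> A) : assigning :=
  fun C => \sum_(e in sub_edges (val C)) f e *~ eta D C (o C) e != 0.

Definition is_coloring (D : orientation G) (f : edge G -> A)
    (c : {ffun vertex G -> A}) : bool :=
  [forall e, c (edge_head D e) - c (edge_tail D e) != f e].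

Definition num_colorings (D : orientation G) (f : edge G -> A) : nat :=
  #|[set c : {ffun vertex G -> A} | is_coloring D f c]|.

End Graph.

(* Main.v *)
Require Import Defs.
From mathcomp Require Import all_boot all_order all_algebra.
From mathcomp Require Import zify.

Set Implicit Arguments.
Unset Strict Implicit.
Unset Printing Implicit Defensive.
Import GRing.Theory.
Local Open Scope ring_scope.

(** Inclusion-exclusion over the edges at which the condition
    [c(head) - c(tail) != f e] fails writes the number of colorings as the sum,
    over all edge sets [T], of [(-1) ^ |T|] times the number of potentials of
    [f] on [T], that is, of maps [c] with [c(head) - c(tail) = f e] for every
    [e] in [T] ([num_colorings_incl_excl]). An edge set is the same thing as a
    spanning subgraph ([sum_spanning]), so it remains to count potentials.

    If [T] has a potential [c], the signed sum of [f] around a cycle of [T] is a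
    signed sum of differences of [c], in which every vertex of the cycle is
    counted once as a head and once as a tail; hence it vanishes
    ([cycle_sum_diff]) and [T] is compatible ([potential_balanced]). So an
    incompatible [T] contributes 0.

    If [T] is compatible, a potential is built one edge at a time
    ([balanced_potential]). Let [c] be a potential on [T] minus an edge [e]. If
    the ends of [e] lie in different components, adding a constant to [c] on one
    of them gives the right difference along [e]. Otherwise [e] closes a cycle
    of [T] ([cycle_through_edge]); the sums of [f] and of the differences of [c]
    around it are both 0 and agree off [e], so they agree on [e] as well.
    Finally two potentials on [T] differ by a map that is constant on the
    components of [T], so there are [|A| ^ c(T)] of them ([card_potentials]). *)

(** * Edge sets: adjacency, degrees, and cycles through an edge *)

Section EdgeSets.
Variable G : graph.
Implicit Types (T : {set edge G}) (x y v w : vertex G) (e : edge G).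

(** The relation [adj] of a subgraph depends only on its edges: [adj H] is
    convertible to [edge_adj (sub_edges H)]. Working with edge sets lets one
    compare subgraphs with different vertex sets. *)
Definition edge_adj T : rel (vertex G) :=
  fun u v => [exists e in T, exists b,
    (endpoint e b == u) && (endpoint e (~~ b) == v)].

Lemma edge_adjP T x y :
  reflect (exists2 e, e \in T &
             exists b, endpoint e b = x /\ endpoint e (~~ b) = y)
          (edge_adj T x y).
Proof.
apply: (iffP exists_inP) => [[e eT /existsP[b /andP[/eqP ? /eqP ?]]]|].
  by exists e => //; exists b.
case=> e eT [b [ex ey]]; exists e => //; apply/existsP; exists b.
by rewrite ex ey !eqxx.
Qed.

Lemma edge_adj_end T e b : e \in T -> edge_adj T (endpoint e b) (endpoint e (~~ b)).
Proof. by move=> eT; apply/edge_adjP; exists e => //; exists b. Qed.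

Lemma edge_adj_sym T : symmetric (edge_adj T).
Proof.
suff H x y : edge_adj T x y -> edge_adj T y x by move=> x y; apply/idP/idP; apply: H.
case/edge_adjP=> e eT [b [<- <-]]; rewrite -[in X in edge_adj _ _ X](negbK b).
exact: edge_adj_end.
Qed.

Lemma edge_connect_sym T : connect_sym (edge_adj T).
Proof. exact/sym_connect_sym/edge_adj_sym. Qed.

Lemma edge_adj_subset T1 T2 : T1 \subset T2 -> subrel (edge_adj T1) (edge_adj T2).
Proof.
move=> /subsetP sT x y /edge_adjP[e eT [b [<- <-]]].
exact/edge_adj_end/sT.
Qed.

Lemma edge_connect_subset T1 T2 :
  T1 \subset T2 -> subrel (connect (edge_adj T1)) (connect (edge_adj T2)).
Proof.
by move=> sT; apply: connect_sub => x y /(edge_adj_subset sT); apply: connect1.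
Qed.

Definition ends_at T v : nat := (\sum_(e in T) \sum_b (endpoint e b == v))%N.

(** Degrees as iterated sums over edges, so that adding an edge is a
    [big_setU1] step. *)
Lemma degreeE (H : subgraph G) v : degree H v = ends_at (sub_edges H) v.
Proof.
rewrite /degree /ends_at pair_big /= -sum1dep_card big_mkcondr /=.
apply: eq_big => [d|d _]; first by rewrite andbT.
by case: eqP.
Qed.

Lemma ends_at_setU1 T e b v : e \notin T ->
  ends_at (e |: T) v
    = ((endpoint e b == v) + (endpoint e (~~ b) == v) + ends_at T v)%N.
Proof.
move=> eT; rewrite /ends_at big_setU1 //= big_bool /=; congr (_ + _)%N.
by case: b; rewrite //= addnC.
Qed.

(** A simple path is followed by a connected edge set in which interior vertices
    have degree 2. The two extra terms [x == v] and [last x p == v] in the last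
    clause say that the path lacks one end at each of its extremities; when
    [p] is empty both ends are missing at [x]. Written this way, the clause
    becomes exactly the degree condition of a cycle once an edge (or a loop)
    joining [x] to [last x p] is added. *)
Lemma path_edge_set T x p : path (edge_adj T) x p -> uniq (x :: p) ->
  exists P : {set edge G},
    [/\ P \subset T,
        forall e b, e \in P -> endpoint e b \in x :: p,
        forall y, y \in x :: p -> connect (edge_adj P) x y
      & forall v, (ends_at P v + (x == v) + (last x p == v) = (v \in x :: p).*2)%N].
Proof.
elim: p x => [|y p IHp] x.
  move=> _ _; exists set0; split; rewrite ?sub0set //.
  - by move=> e b; rewrite inE.
  - by move=> y; rewrite inE => /eqP ->.
  - by move=> v; rewrite /ends_at big_set0 inE eq_sym; case: eqP.
case/andP=> /edge_adjP[e eT [b [ex ey]]] /IHp{}IHp /andP[xp /IHp].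
case=> P [sPT endP conP degP].
(* the new edge is new because its end [x] is not on the rest of the path *)
have eP : e \notin P by apply: contra xp => /(endP _ b); rewrite ex.
have sPeP : P \subset e |: P by apply: subsetUr.
exists (e |: P); split.
- by rewrite subUset sub1set eT.
- move=> e' b'; rewrite in_setU1 => /orP[/eqP ->|/(endP _ b')].
    rewrite !inE; case: (eqVneq b' b) => [->|]; first by rewrite ex eqxx.
    by move=> /negPf; case: b' b ex ey {IHp} => -[] //= _ -> _; rewrite eqxx orbT.
  by move=> ep; rewrite in_cons ep orbT.
- move=> z; rewrite in_cons => /orP[/eqP -> //|/conP yz].
  apply: connect_trans (edge_connect_subset sPeP yz).
  apply: connect1; rewrite -ex -ey; apply: edge_adj_end; exact: setU11.
- move=> v; rewrite (ends_at_setU1 b) // ex ey /= in_cons.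
  have := degP v; rewrite eq_sym; case: (eqVneq v x) => [->|_] /=.
    by rewrite (negPf xp) eq_sym /=; lia.
  by lia.
Qed.

(** The cycle consists of [e] and of a simple path between its ends; a loop [e]
    corresponds to the path of length 0. *)
Lemma cycle_through_edge T e : e \notin T ->
    connect (edge_adj T) (endpoint e true) (endpoint e false) ->
  exists2 C : graph_cycle G,
    e \in sub_edges (val C) & sub_edges (val C) \subset e |: T.
Proof.
move=> eT /connectP[p0 p0path p0last].
case/shortenP: p0path p0last => p ppath puniq _ plast.
have [P [sPT endP conP degP]] := path_edge_set ppath puniq.
have eP : e \notin P by apply: contra eT; apply/subsetP.
have subC : is_subgraph ([set v in endpoint e true :: p], e |: P).
  apply/forall_inP => e' /=; rewrite in_setU1 => e'P; apply/forallP => b.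
  rewrite inE; case/orP: e'P => [/eqP ->|/(endP _ b) //].
  by case: b; rewrite ?plast ?mem_last ?mem_head.
pose H : subgraph G := Sub _ subC.
have cycH : is_cycle H.
  have sPeP : P \subset e |: P by apply: subsetUr.
  apply/andP; split.
    have symC := edge_connect_sym (e |: P).
    apply/eqP; rewrite -(n_comp_connect symC (endpoint e true)).
    apply: eq_n_comp_r => v; rewrite /sub_verts SubK inE; apply/idP/idP.
      by move=> /conP; apply: edge_connect_subset.
    (* conversely, the end of a nonempty path in [e |: P] is an end of one of
       these edges, hence lies in the vertex set *)
    case/connectP=> q qpath ->.
    elim/last_ind: q qpath => [|q z _]; first by rewrite mem_head.
    rewrite rcons_path last_rcons => /andP[_ /edge_adjP[e' e'P [b [_ <-]]]].
    have /forall_inP/(_ _ e'P)/forallP/(_ (~~ b)) := subC.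
    by rewrite inE.
  apply/forall_inP => v; rewrite /sub_verts SubK in_set => vp.
  rewrite degreeE /sub_edges SubK (ends_at_setU1 true) //= plast.
  by have := degP v; rewrite -plast vp; lia.
exists (Sub H cycH : graph_cycle G); first exact: setU11.
exact: setUS.
Qed.

End EdgeSets.

(** * Potentials on an edge set *)

Section Potentials.
Variables (G : graph) (D : orientation G) (A : finZmodType).
Implicit Types (T : {set edge G}) (c : {ffun vertex G -> A}) (f : edge G -> A).

(** Reversing [D] along [o] absorbs the signs [eta], leaving the sum of [c] over
    the heads minus the sum of [c] over the tails of the edges, for [o]. Both
    are the sum of [c] over the vertices of the cycle. *)
Lemma cycle_sum_diff (C : graph_cycle G) (o : orientation G) c :
  is_direction C o ->
  \sum_(e in sub_edges (val C))
    (c (edge_head D e) - c (edge_tail D e)) *~ eta D C o e = 0.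
Proof.
move=> o_dir.
have endC e b : e \in sub_edges (val C) -> endpoint e b \in sub_verts (val C).
  by move=> eC; have /forall_inP/(_ _ eC)/forallP/(_ b) := valP (val C).
have collect (w : edge G -> vertex G) :
    (forall e, e \in sub_edges (val C) -> w e \in sub_verts (val C)) ->
    (forall v, v \in sub_verts (val C) ->
       #|[set e in sub_edges (val C) | w e == v]| = 1%N) ->
    \sum_(e in sub_edges (val C)) c (w e) = \sum_(v in sub_verts (val C)) c v.
  move=> wC w1; rewrite (partition_big w (mem (sub_verts (val C)))) //=.
  apply: eq_bigr => v vC.
  rewrite (eq_bigr (fun=> c v)) => [|e /andP[_ /eqP -> //]].
  rewrite -[RHS]mulr1n -(w1 v vC) -sumr_const.
  by apply: eq_bigl => e; rewrite inE.
rewrite (eq_bigr (fun e => c (edge_head o e) - c (edge_tail o e))) => [|e eC].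
  rewrite sumrB !collect ?subrr // => [e|v|e|v]; do ?[exact: endC].
    by case/o_dir.
  by case/o_dir.
rewrite /eta eC /edge_head /edge_tail.
by case: (D e) (o e) => -[]; rewrite /= ?mulrNz mulr1z ?opprB.
Qed.

Definition is_potential f T c : bool :=
  [forall e in T, c (edge_head D e) - c (edge_tail D e) == f e].

(** Compatibility with the assigning induced by [f], phrased for the edge set of
    a spanning subgraph; see [compatible_balanced]. *)
Definition balanced (o : graph_cycle G -> orientation G) f T : Prop :=
  forall C : graph_cycle G, sub_edges (val C) \subset T ->
    \sum_(e in sub_edges (val C)) f e *~ eta D C (o C) e = 0.

Lemma potential_balanced o f T c :
  (forall C, is_direction C (o C)) -> is_potential f T c -> balanced o f T.
Proof.
move=> o_dir /forall_inP cT C /subsetP sCT.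
rewrite -[RHS](cycle_sum_diff c (o_dir C)); apply: eq_bigr => e /sCT/cT/eqP -> //.
Qed.

Lemma edge_connect_ends T e : e \in T ->
  connect (edge_adj T) (edge_tail D e) (edge_head D e).
Proof.
move=> eT; apply: connect1; rewrite edge_adj_sym; exact: edge_adj_end.
Qed.

(** The converse of [potential_balanced]: the cycle conditions are the only
    obstruction to solving [c(head) - c(tail) = f] on [T]. *)
Lemma balanced_potential o f T :
  (forall C, is_direction C (o C)) -> balanced o f T ->
  exists c, is_potential f T c.
Proof.
move=> o_dir; have [n] := ubnP #|T|; elim: n T => // n IHn T leTn balT.
have [->|[e eT]] := set_0Vmem T.
  by exists [ffun=> 0]; apply/forall_inP => e; rewrite inE.
pose T' := T :\ e; have defT : T = e |: T' by rewrite setD1K.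
have eT' : e \notin T' by rewrite setD11.
have [c /forall_inP cT'] : exists c, is_potential f T' c.
  apply: IHn; first by move: leTn; rewrite (cardsD1 e T) eT.
  by move=> C sCT'; apply: balT; apply: subset_trans sCT' (subD1set _ _).
pose h := edge_head D e; pose t := edge_tail D e.
have [con|ncon] := boolP (connect (edge_adj T') t h).
  (* [e] closes a cycle, which forces [c] to be right on [e] already *)
  exists c; apply/forall_inP => e'; rewrite defT in_setU1.
  case/orP=> [/eqP -> {e'}|/cT' //].
  have [|C eC sCT] := cycle_through_edge eT'.
    move: con; rewrite /t /h /edge_tail /edge_head.
    by case: (D e) => //; rewrite edge_connect_sym.
  rewrite -defT in sCT.
  have := etrans (balT C sCT) (esym (cycle_sum_diff c (o_dir C))).
  rewrite !(bigD1 e eC) /=.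
  rewrite [X in _ + X](eq_bigr (fun e =>
    (c (edge_head D e) - c (edge_tail D e)) *~ eta D C (o C) e)).
    move/addIr; rewrite /eta eC.
    by case: ifP => _; rewrite ?mulrNz ?mulr1z; [move=> ->|move=> /oppr_inj ->].
  move=> e' /andP[/(subsetP sCT)].
  by rewrite defT in_setU1 => /orP[->|/cT'/eqP ->].
(* the shift [d] corrects [e]; every other edge lies inside one component, so
   the difference along it does not change *)
pose d := f e - (c h - c t).
exists [ffun v => c v + (if connect (edge_adj T') h v then d else 0)].
apply/forall_inP => e'; rewrite !ffunE defT in_setU1 => /orP[/eqP -> {e'}|e'T'].
  rewrite -/h -/t connect0 edge_connect_sym (negPf ncon) addr0 /d.
  by rewrite addrAC addrC subrK.
rewrite -(same_connect_r (edge_connect_sym T') (edge_connect_ends e'T')).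
by rewrite opprD addrACA subrr addr0; apply: cT'.
Qed.

(** Potentials are the translates of [c0] by the maps constant on components,
    and such a map is determined by its values at the component representatives
    [roots]. The values off [roots] are set to 0, which makes these maps a
    [pffun_on] of known cardinality. *)
Lemma card_potentials f T c0 : is_potential f T c0 ->
  #|[set c | is_potential f T c]| = (#|A| ^ n_comp (edge_adj T) setT)%N.
Proof.
move=> /forall_inP c0T; pose rt := fingraph.root (edge_adj T).
pose Q := [predI roots (edge_adj T) & [set: vertex G]].
pose shift (h : {ffun vertex G -> A}) := [ffun v => c0 v + h (rt v)].
have symT := edge_connect_sym T.
have rt_id v : v \in Q -> rt v = v by move=> /andP[/eqP].
have Qrt v : rt v \in Q by rewrite !inE andbT; apply: roots_root.
have -> : [set c | is_potential f T c] = shift @: pffun_on 0 Q (@predT A).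
  apply/setP => c; rewrite inE; apply/idP/imsetP => [/forall_inP cT|[h _ ->]].
    (* [d] does not change along an edge of [T], hence along a path *)
    pose d v := c v - c0 v.
    have d_rt v : d (rt v) = d v.
      apply/esym; have /connectP[p] := connect_root (edge_adj T) v.
      rewrite -/(rt v); move: (rt v) => z.
      elim: p v => [|w p IHp] v /=; first by move=> _ ->.
      case/andP=> /edge_adjP[e eT [b [<- <-]]] /IHp{}IHp /IHp <-.
      have : d (edge_head D e) = d (edge_tail D e).
        have := cT e eT; rewrite -(eqP (c0T e eT)) => /eqP E.
        by apply/eqP; rewrite -subr_eq0 /d opprD addrACA E -opprD subrr.
      by rewrite /edge_head /edge_tail; case: (D e) b {IHp} => -[] //= ->.
    exists [ffun v => if v \in Q then d v else 0].
      apply/pffun_onP; split=> //; apply/supportP => v vQ.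
      by rewrite ffunE (negPf vQ).
    by apply/ffunP => v; rewrite !ffunE Qrt d_rt addrC subrK.
  apply/forall_inP => e eT; rewrite !ffunE.
  have -> : rt (edge_head D e) = rt (edge_tail D e).
    by apply/eqP; rewrite eq_sym root_connect //; apply: edge_connect_ends.
  by rewrite opprD addrACA subrr addr0; apply: c0T.
rewrite card_in_imset ?card_pffun_on // => h1 h2.
move=> /pffun_onP[/supportP h1Q _] /pffun_onP[/supportP h2Q _].
move=> /ffunP E; apply/ffunP => v.
have [vQ|vQ] := boolP (v \in Q); last by rewrite h1Q ?h2Q.
by have := E v; rewrite !ffunE rt_id // => /addrI.
Qed.

(** The indicator of colorings is the product over [e] of one minus the indicator
    that [e] is violated; expanding it, the term of [T] is, up to sign, the
    indicator that all edges of [T] are violated. *)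
Lemma num_colorings_incl_excl f :
  (num_colorings D f)%:Z =
  \sum_(T : {set edge G}) (-1) ^+ #|T| * #|[set c | is_potential f T c]|%:Z.
Proof.
pose hit c e : int := (c (edge_head D e) - c (edge_tail D e) == f e)%:R.
have coloringE c : (is_coloring D f c)%:R = \prod_e (- hit c e + 1).
  case: (boolP (is_coloring D f c)) => [/forallP cc|/forallPn[e]].
    by rewrite big1 // => e _; rewrite /hit (negPf (cc e)) oppr0 add0r.
  by rewrite negbK => ce; rewrite (bigD1 e) //= /hit ce addNr mul0r.
transitivity (\sum_(c : {ffun vertex G -> A}) \prod_e (- hit c e + 1)).
  rewrite /num_colorings -sum1dep_card big_mkcond /= -natz natr_sum.
  by apply: eq_bigr => c _; rewrite -coloringE; case: is_coloring.
under eq_bigr do rewrite bigA_distr.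
rewrite exchange_big; apply: eq_bigr => T _ /=.
rewrite -sum1dep_card -natz natr_sum mulr_sumr [RHS]big_mkcond /=.
apply: eq_bigr => c _; rewrite -big_mkcond prodrN.
case: ifP => [/forall_inP cT|/negbT/forall_inPn[e eT ce]].
  by congr (_ * _); rewrite big1 // => e /cT ce; rewrite /hit ce.
by rewrite (bigD1 e eT) /= /hit (negPf ce) mul0r mulr0.
Qed.

End Potentials.

(** * Spanning subgraphs as edge sets *)

Section SpanningSubgraphs.
Variable G : graph.

Lemma is_subgraph_setT (T : {set edge G}) : is_subgraph (setT, T).
Proof. by apply/forall_inP => e _; apply/forallP => b; rewrite inE. Qed.

Definition spanning_subgraph T : subgraph G := Sub _ (is_subgraph_setT T).

Lemma sum_spanning (F : subgraph G -> int) (P : pred (subgraph G)) :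
  \sum_(H : subgraph G | spanning H && P H) F H
    = \sum_(T : {set edge G} | P (spanning_subgraph T)) F (spanning_subgraph T).
Proof.
rewrite (reindex_onto spanning_subgraph (@sub_edges G)) /=.
  by apply: eq_bigl => T; rewrite /spanning eqxx /= /sub_edges SubK eqxx andbT.
move=> H /andP[/eqP spanH _]; apply: val_inj.
by rewrite SubK -spanH; case: H {spanH} => -[].
Qed.

Lemma compatible_balanced D (A : finZmodType) (f : edge G -> A) o T :
  reflect (balanced D o f T)
          (compatible (induced_assigning D o f) (spanning_subgraph T)).
Proof.
have subE C :
    subgraph_of (val C) (spanning_subgraph T) = (sub_edges (val C) \subset T).
  by rewrite /subgraph_of subsetT.
apply: (iffP forallP) => bal C.
  by move=> sCT; have := bal C; rewrite subE sCT /= eqbF_neg negbK => /eqP.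
by apply/implyP; rewrite subE => /bal sum0; rewrite eqbF_neg negbK sum0.
Qed.

End SpanningSubgraphs.

Theorem theorem2p1 (G : graph) (D : orientation G) (A : finZmodType)
    (f : edge G -> A) (o : graph_cycle G -> orientation G)
    (o_dir : forall C : graph_cycle G, is_direction C (o C)) :
  (num_colorings D f)%:Z =
  \sum_(H : subgraph G | spanning H && compatible (induced_assigning D o f) H)
    (-1) ^+ #|sub_edges H| * #|A|%:Z ^+ ncomponents H.
Proof.
rewrite sum_spanning num_colorings_incl_excl [RHS]big_mkcond /=.
apply: eq_bigr => T _; case: compatible_balanced => [balT|unbalT].
  have [c0 c0T] := balanced_potential o_dir balT.
  by rewrite (card_potentials c0T) -!natz natrX.
rewrite (_ : [set c | _] = set0) ?cards0 ?mulr0 //.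
apply/setP => c; rewrite !inE; apply/negP => cT.
exact/unbalT/(potential_balanced o_dir cT).
Qed.
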